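(* Let $\mathcal{T}$ be a (stationary, finite) $k$-spacetree, $k\ge 2$, whose root is a square/cube in $\mathbb{R}^d$, $d\in\{2,3\}$, and let $\mathbb{M}$ be a finite set of particles with positions $x(m)\in\mathbb{R}^d$. Initially every particle is assigned to a leaf of $\mathcal{T}$ that covers its position. Run an arbitrary sequence of tree traversals, each consisting of one event $\mathrm{enterCell}(c)$ and one event $\mathrm{leaveCell}(c)$ per cell $c\in\mathcal{T}$, ordered in accordance with the traversal constraint, where the events perform the operations of the particle-in-tree (PIT) algorithm (traversal constraint and algorithm are given in the context). Then, whenever $\mathrm{enterCell}$ is invoked on a leaf $a\in\mathcal{T}$ and all its preamble operations have terminated, every particle assigned to $a$ at that moment has a position $x$ covered by $a$.
   Context: **Spacetree.** The root is a $d$-dimensional square/cube spanning the whole computational domain. A cell is refined by cutting it into $k$ equal parts along each coordinate axis, yielding $k^d$ child squares/cubes that tessellate it. For each cell one decides whether to refine further. The resulting finite set of cells is $\mathcal{T}$; write $a\sqsubseteq_{child\ of} b$ if $a$ is one of the $k^d$ children of $b$ ($b$ is then the parent of $a$). A cell without children is a leaf (unrefined); otherwise it is refined. A cell covers (contains) a position $x$ if $x$ lies in the square/cube it represents. **Traversal constraint.** In each traversal the events are ordered in time such that: if $a\sqsubseteq_{child\ of} b$, then $\mathrm{enterCell}(b)$ is executed before $\mathrm{enterCell}(a)$ and $\mathrm{leaveCell}(a)$ before $\mathrm{leaveCell}(b)$; and for every cell $c$, $\mathrm{enterCell}(c)$ is executed before $\mathrm{leaveCell}(c)$. Traversals are executed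 one after another. **PIT algorithm.** At any time each particle $m$ is assigned to (associated with) exactly one cell of $\mathcal{T}$. $\mathrm{enterCell}(c)$: 1. (Preamble) If $c$ is refined: for every $m$ assigned to $c$, identify a child $c'\sqsubseteq_{child\ of} c$ containing $x(m)$ and assign $m$ to $c'$ (drop). 2. Application-specific operations. 3. If $c$ is unrefined: for every $m$ assigned to $c$, update the position $x(m)$ (move). 4. Application-specific operations. $\mathrm{leaveCell}(c)$: 1. Application-specific operations. 2. (Epilogue) For every $m$ assigned to $c$: if $x(m)$ is not contained in $c$, assign $m$ to the parent $c'$ of $c$, i.e. $c\sqsubseteq_{child\ of} c'$ (lift). **Conventions.** The new position in a move is arbitrary (no bound on the distance travelled) except that particles always stay within the computational domain, i.e. within the root cell. Application-specific operations change neither particle positions nor particle assignments. *)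

(* Defs.v *)
From HB Require Import structures.
From mathcomp Require Import all_boot all_order all_algebra.
From mathcomp Require Import finmap.
From mathcomp Require Import reals.

Set Implicit Arguments.
Unset Strict Implicit.
Unset Printing Implicit Defensive.

Import Order.TTheory GRing.Theory Num.Theory.

Local Open Scope fset_scope.
Local Open Scope ring_scope.

(* The pair (p, h) encodes the closed axis-parallel cube
   [p_1, p_1 + h] x ... x [p_d, p_d + h]. *)
Notation cube R d := ('rV[R]_d * R)%type.

Section Spacetree.
Variables (R : realType) (d k : nat).
Implicit Types (a b c : cube R d) (T : {fset cube R d}).

Definition corner c : 'rV[R]_d := c.1.
Definition side c : R := c.2.

Definition contains c (x : 'rV[R]_d) : bool :=
  [forall i, corner c 0 i <= x 0 i <= corner c 0 i + side c].

Definition subcube c (j : {ffun 'I_d -> 'I_k}) : cube R d :=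
  (\row_i (corner c 0 i + (j i)%:R * (side c / k%:R)), side c / k%:R).

Definition child_of a b : bool := [exists j, a == subcube b j].

Definition refined T c : bool := [exists a : T, child_of (val a) c].

Inductive spacetree (root : cube R d) : {fset cube R d} -> Prop :=
| spacetree_root : spacetree root [fset root]
| spacetree_refine T c :
    spacetree root T -> c \in T -> ~~ refined T c ->
    spacetree root (T `|` [fset subcube c j | j : {ffun 'I_d -> 'I_k}]).

(* The children of a cube cover it, so that the drop in the PIT preamble
   always finds a target. *)
Lemma contains_subcube c x :
  (0 < k)%N -> contains c x -> exists j, contains (subcube c j) x.
Proof.
move=> k_gt0 /forallP cx.
have grid (p w y : R) n : (0 < n)%N -> p <= y <= p + n%:R * w ->
    exists j : 'I_n, p + j%:R * w <= y <= p + j%:R * w + w.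
  elim: n => // n IHn _ /andP[py yn].
  have [n0|n_gt0] := posnP n.
    by exists ord0; rewrite mul0r addr0 py; move: yn; rewrite n0 mul1r.
  have [yle|ygt] := leP y (p + n%:R * w).
    have [|j pj] := IHn n_gt0; first by rewrite py.
    by exists (widen_ord (leqnSn n) j).
  exists ord_max; rewrite (ltW ygt) /=.
  by move: yn; rewrite -natr1 mulrDl mul1r addrA.
have k_neq0 : k%:R != 0 :> R by rewrite pnatr_eq0 -lt0n.
have /fin_all_exists[j jP] (i : 'I_d) : exists j : 'I_k,
    corner c 0 i + j%:R * (side c / k%:R) <= x 0 i
      <= corner c 0 i + j%:R * (side c / k%:R) + side c / k%:R.
  by apply: grid => //; rewrite mulrC divfK.
by exists [ffun i => j i]; apply/forallP => i; rewrite mxE ffunE.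
Qed.

End Spacetree.

Variant event (C : Type) := Enter of C | Leave of C.

Section EventEq.
Variable C : eqType.

Definition sum_of_event (e : event C) : C + C :=
  match e with Enter c => inl c | Leave c => inr c end.

Definition event_of_sum (s : C + C) : event C :=
  match s with inl c => Enter c | inr c => Leave c end.

Lemma sum_of_eventK : cancel sum_of_event event_of_sum.
Proof. by case. Qed.

HB.instance Definition _ := Equality.copy (event C) (can_type sum_of_eventK).

End EventEq.

Section PIT.
Variables (R : realType) (d k : nat) (root : cube R d) (T : {fset cube R d}).
Variable M : finType.
Implicit Types (a b c : T) (e : event T) (s : seq (event T)) (m : M).

Definition executed_before s e e' : bool := (index e s < index e' s)%N.

Definition traversal s : Prop :=
  [/\ forall e, count_mem e s = 1%N,
      forall a b, child_of k (val a) (val b) ->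
        executed_before s (Enter b) (Enter a) /\
        executed_before s (Leave a) (Leave b)
    & forall c, executed_before s (Enter c) (Leave c)].

Definition leaf c : bool := ~~ refined k T (val c).

Record state := State { pos : M -> 'rV[R]_d; cell : M -> T }.
Implicit Types st : state.

Definition application_ops st st' : Prop :=
  forall m, pos st' m = pos st m /\ cell st' m = cell st m.

Definition preamble c st st' : Prop :=
  forall m, pos st' m = pos st m /\
    if ~~ leaf c && (cell st m == c)
    then child_of k (val (cell st' m)) (val c) /\
         contains (val (cell st' m)) (pos st m)
    else cell st' m = cell st m.

Definition move_particles c st st' : Prop :=
  forall m, cell st' m = cell st m /\
    if leaf c && (cell st m == c)
    then (contains root (pos st' m) : Prop)
    else pos st' m = pos st m.

Definition epilogue c st st' : Prop :=
  forall m, pos st' m = pos st m /\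
    if (cell st m == c) && ~~ contains (val c) (pos st m)
    then (child_of k (val c) (val (cell st' m)) : Prop)
    else cell st' m = cell st m.

Definition execute e st st' : Prop :=
  match e with
  | Enter c => exists st1 st2 st3,
      [/\ preamble c st st1, application_ops st1 st2,
          move_particles c st2 st3 & application_ops st3 st']
  | Leave c => exists st1, application_ops st st1 /\ epilogue c st1 st'
  end.

Inductive run st0 : seq (event T) -> state -> Prop :=
| run_nil : run st0 [::] st0
| run_rcons s e st st' :
    run st0 s st -> execute e st st' -> run st0 (rcons s e) st'.

End PIT.

(* Main.v *)
(* At any time a particle outside its cell [c] sits in a cell that is open,
   i.e. entered but not yet left in the current traversal: moves happen when a
   leaf is entered, and when [leaveCell c] lifts a particle, the traversal
   constraint makes the parent of [c] still open. A leaf that is about to be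
   entered is not open, so it covers the particles assigned to it. *)

Require Import Defs.
From mathcomp Require Import all_boot all_order all_algebra.
From mathcomp Require Import finmap.
From mathcomp Require Import reals.
From mathcomp Require Import zify.

Import Order.TTheory GRing.Theory Num.Theory.

Local Open Scope ring_scope.

Set Implicit Arguments.
Unset Strict Implicit.

Lemma flatten_split (X : Type) (ss : seq (seq X)) (u v : seq X) (e : X) :
  flatten ss = u ++ e :: v ->
  exists ss1 p q ss2, ss = ss1 ++ (p ++ e :: q) :: ss2 /\ u = flatten ss1 ++ p.
Proof.
elim: ss u => [|s ss IHss] /=; first by case.
elim: s => [|x s IHs] u.
  by move=> /IHss[ss1 [p [q [ss2 [-> ->]]]]]; exists ([::] :: ss1), p, q, ss2.
case: u => [[-> _]|y u]; first by exists [::], [::], s, ss.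
case=> -> /IHs[[|t ss1] [p [q [ss2 [[-> ->] ->]]]]].
  by exists [::], (y :: p), q, ss2.
by exists ((y :: t) :: ss1), p, q, ss2.
Qed.

Section UniqueOccurrence.
Variables (E : eqType) (p q : seq E) (e e' : E).
Hypothesis e_once : count_mem e (p ++ e :: q) = 1%N.

Lemma count_before_unique : count_mem e p = 0%N.
Proof. by move: e_once; rewrite count_cat /= eqxx; lia. Qed.

Lemma index_unique : index e (p ++ e :: q) = size p.
Proof.
have ep : e \notin p by apply/count_memPn; exact: count_before_unique.
by rewrite index_cat (negPf ep) /= eqxx addn0.
Qed.

(** Counts in a prefix add up over concatenated traversals, while [index] sees only the first
    occurrence. This lemma and the next turn the order of events inside one traversal into such
    counts. *)
Lemma count_index_lt :
  count_mem e' (p ++ e :: q) = 1%N ->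
  (index e' (p ++ e :: q) < index e (p ++ e :: q))%N -> count_mem e' p = 1%N.
Proof.
rewrite index_unique index_cat count_cat.
case: ifPn => [|_]; last by rewrite ltnNge leq_addr.
by rewrite -has_pred1 has_count; lia.
Qed.

Lemma count_index_gt :
  (index e (p ++ e :: q) < index e' (p ++ e :: q))%N -> count_mem e' p = 0%N.
Proof.
rewrite index_unique index_cat => lt_e; apply/count_memPn/negP => e'p.
by move: lt_e; rewrite e'p ltnNge ltnW // index_mem.
Qed.

End UniqueOccurrence.

Section OpenCells.
Variables (C : eqType) (child : rel C).
Implicit Types (a b c : C) (e : event C) (s past future : seq (event C)).

(* [traversal] with an abstract type of cells and an abstract child relation. *)
Definition nested_visits s : Prop :=
  [/\ forall e, count_mem e s = 1%N,
      forall a b, child a b ->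
        (index (Enter b) s < index (Enter a) s)%N /\
        (index (Leave a) s < index (Leave b) s)%N
    & forall c, (index (Enter c) s < index (Leave c) s)%N].

(* Counting from the very first traversal is harmless: a complete traversal
   contributes one to each side. *)
Definition is_open past c : bool :=
  (count_mem (Leave c) past < count_mem (Enter c) past)%N.

Lemma count_flatten_visits ss e :
  (forall s, s \in ss -> nested_visits s) -> count_mem e (flatten ss) = size ss.
Proof.
elim: ss => //= s ss IHss hss; rewrite count_cat IHss => [|t tss].
  by have [-> _ _] := hss s (mem_head _ _).
by apply: hss; rewrite inE tss orbT.
Qed.

Lemma is_open_rcons past e c :
  e != Leave c -> is_open past c -> is_open (rcons past e) c.
Proof.
rewrite /is_open -cats1 !count_cat /= => /negPf->.
by lia.
Qed.

Variable traversals : seq (seq (event C)).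
Hypothesis traversals_nested : forall s, s \in traversals -> nested_visits s.

(** The [n] completed traversals contribute [n] to the count of every event alike, so comparing
    counts in [past] amounts to comparing them in [p], the executed part of the current
    traversal. *)
Lemma current_traversal past e future :
  flatten traversals = past ++ e :: future ->
  exists n p q, nested_visits (p ++ e :: q) /\
    forall e', count_mem e' past = (n + count_mem e' p)%N.
Proof.
move=> /(@flatten_split _ _ _ _ _)[ss1 [p [q [ss2 [sE ->]]]]].
exists (size ss1), p, q; split.
  by apply: traversals_nested; rewrite sE mem_cat mem_head orbT.
move=> e'; rewrite count_cat count_flatten_visits // => s ss1s.
by apply: traversals_nested; rewrite sE mem_cat ss1s.
Qed.

Lemma count_before_enter past c future :
  flatten traversals = past ++ Enter c :: future ->
  count_mem (Enter c) past = count_mem (Leave c) past.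
Proof.
move=> /current_traversal[n [p [q [[once _ enter_leave] countE]]]].
have not_left := count_index_gt (once (Enter c)) (enter_leave c).
have not_entered := count_before_unique (once (Enter c)).
by rewrite !countE not_left not_entered.
Qed.

Lemma closed_before_enter past c future :
  flatten traversals = past ++ Enter c :: future -> ~~ is_open past c.
Proof. by move=> /count_before_enter; rewrite /is_open => ->; rewrite ltnn. Qed.

Lemma open_after_enter past c future :
  flatten traversals = past ++ Enter c :: future ->
  is_open (rcons past (Enter c)) c.
Proof.
move=> /count_before_enter; rewrite /is_open -cats1 !count_cat /= eqxx => ->.
by lia.
Qed.

(** The current traversal has the order [Enter b], [Enter c], [Leave c], [Leave b]. Hence at
    [Leave c] the cell [b] has been entered [n + 1] times and left [n] times. *)
Lemma parent_open_at_leave past c b future :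
  flatten traversals = past ++ Leave c :: future -> child c b ->
  is_open (rcons past (Leave c)) b.
Proof.
move=> /current_traversal[n [p [q [[once nested enter_leave] countE]]]] cb.
have [enter_bc leave_cb] := nested _ _ cb.
have enter_b_leave_c := ltn_trans enter_bc (enter_leave c).
have entered := count_index_lt (once (Leave c)) (once (Enter b)) enter_b_leave_c.
have not_left := count_index_gt (once (Leave c)) leave_cb.
(* The abstract relation [child] may be reflexive a priori; the strict order of the two leave events
   excludes [c = b]. *)
have c_neq_b : (Leave c == Leave b) = false.
  by apply/eqP => E; move: leave_cb; rewrite E ltnn.
rewrite /is_open -cats1 !count_cat !countE /= c_neq_b entered not_left.
by lia.
Qed.

End OpenCells.

Lemma traversal_nested_visits (R : realType) (d k : nat) (T : {fset cube R d})
    (s : seq (event T)) :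
  traversal k s ->
  nested_visits (fun a b : T => child_of k (val a) (val b)) s.
Proof. by []. Qed.

Section Uncovered.
Variables (R : realType) (d k : nat) (root : cube R d) (T : {fset cube R d}).
Variables (M : finType) (st0 : state T M).
Hypothesis hst0 : forall m, contains (val (cell st0 m)) (pos st0 m).
Variable traversals : seq (seq (event T)).
Hypothesis htr : forall s, s \in traversals -> traversal k s.

Lemma uncovered_in_open_cell past future st m :
  flatten traversals = past ++ future -> run k root st0 past st ->
  ~~ contains (val (cell st m)) (pos st m) -> is_open past (cell st m).
Proof.
have htr' s hs := traversal_nested_visits (@htr s hs).
move=> E hrun.
(* [future] is generalised because the induction hypothesis is used with the last event [e] put back
   in front of it. *)
elim: hrun future m E => {past st} [|past e st st' _ IH ex] future m.
  by rewrite hst0.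
rewrite cat_rcons => E.
have {}IH := IH _ m E.
case: e E ex => c E /=.
  move=> [st1 [st2 [st3 [/(_ m)[p1 c1] /(_ m)[p2 c2] /(_ m)[c3 p3]
    /(_ m)[p4 c4]]]]].
  (* A particle neither dropped nor moved was already uncovered before, and entering a cell closes
     no other. *)
  have keep : cell st1 m = cell st m -> pos st3 m = pos st2 m ->
      ~~ contains (val (cell st' m)) (pos st' m) ->
      is_open (rcons past (Enter c)) (cell st' m).
    move=> cE pE; rewrite c4 c3 c2 cE p4 pE p2 p1 => /IH.
    exact: is_open_rcons.
  case: (boolP (leaf k c)) c1 p3 => [leaf_c /= c1|nleaf /=].
    (* A particle moved in the leaf [c] may end anywhere, but [c] has just been opened. *)
    rewrite c2; case: eqP => [cc _ _|_ pE]; last exact: keep.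
    by rewrite c4 c3 c2 cc; exact: (open_after_enter htr' E).
  (* A dropped particle is covered by its new cell and does not move, so it cannot be uncovered. *)
  case: eqP => [_ [_ cov] pE|_ cE pE]; last exact: keep.
  by rewrite c4 c3 c2 p4 pE p2 p1 cov.
move=> [st1 [/(_ m)[p1 c1] /(_ m)[p2]]].
rewrite p2 c1 p1; case: eqP => [cc|ncc] /=.
  (* A particle of [c] is either lifted to a parent, which is still open, or stays in [c] and is
     covered. *)
  case: ifPn => [_ par _|/negPn cov ->]; last by rewrite cc => /negP/(_ cov).
  exact: (parent_open_at_leave htr' E par).
move=> -> /IH; apply: is_open_rcons.
by apply/eqP => -[/esym].
Qed.

End Uncovered.

Unset Implicit Arguments.
Set Strict Implicit.

Theorem theorem5p1 (R : realType) (d k : nat)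
  (hd : d = 2%N \/ d = 3%N) (hk : (2 <= k)%N)
  (root : cube R d) (hroot : 0 < side root)
  (T : {fset cube R d}) (hT : spacetree k root T)
  (M : finType) (st0 : state T M)
  (hst0 : forall m : M, leaf k (cell st0 m) /\
                        contains (val (cell st0 m)) (pos st0 m))
  (traversals : seq (seq (event T)))
  (htr : forall s, s \in traversals -> traversal k s)
  (past future : seq (event T)) (a : T) (ha : leaf k a)
  (hnow : flatten traversals = past ++ Enter a :: future)
  (st st' : state T M)
  (hrun : run k root st0 past st) (hpre : preamble k a st st')
  (m : M) (hm : cell st' m = a) :
  contains (val a) (pos st' m).
Proof.
have [-> cell_eq] := hpre m.
(* The preamble of a leaf reassigns nothing, so the claim is about [st], the state just before
   [Enter a]. *)
move: cell_eq; rewrite ha /= hm => am; rewrite am.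
apply/negPn/negP => uncov.
have cov0 m' : contains (val (cell st0 m')) (pos st0 m') by case: (hst0 m').
have := uncovered_in_open_cell cov0 htr hnow hrun uncov.
rewrite -am; apply/negP; apply: closed_before_enter hnow => s /htr.
exact: traversal_nested_visits.
Qed.
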